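(* There is an optimal quantum online algorithm with shared qubits for the Paging problem that uses $n/2$ qubits of advice, where $n$ is the length of the request sequence.
   Context: Paging problem: there is a slow memory of $N$ pages and a fast memory (cache) holding $k<N$ pages. The input is a sequence of $n$ requests, each specifying a page. A request is served if the page is in the cache; otherwise a page fault occurs and some page must be evicted from the cache so that the requested page can be loaded. An online algorithm decides which page to evict at each fault, knowing only the requests so far; the cost is the total number of evicted pages. A quantum online algorithm with advice receives a quantum message of at most $b$ qubits from an Adviser who knows the whole input, may have classical and quantum parts and measure at any time; it has shared qubits if, before computation, it prepares qubits (possibly entangled) and sends part of them to the Adviser. It is optimal if for every input there is an advice message with expected cost at most $cost(Opt(I))$, $Opt$ an optimal offline algorithm. *)

(* Defs.v *)
From mathcomp Require Import all_boot all_order all_algebra.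
From mathcomp Require Import reals.
From mathcomp.real_closed Require Import complex mxtens.

Set Implicit Arguments.
Unset Strict Implicit.
Unset Printing Implicit Defensive.

Import Order.TTheory GRing.Theory Num.Theory.
Local Open Scope ring_scope.
Local Open Scope complex_scope.
Local Open Scope sesquilinear_scope.

Section Paging.

Variables N k : nat.

Local Notation page := 'I_N.

(* An answer [Some p] evicts p; [None] evicts nothing. A page is evicted
   exactly on the faults that find the cache full; a fault on a cache with a
   free slot (possible only if the initial cache is not full) just loads the
   requested page. *)
Definition legal_answer (c : {set page}) (x : page) (y : option page) : bool :=
  if (x \in c) || (#|c| < k)%N then y == None
  else if y is Some p then p \in c else false.

Definition next_cache (c : {set page}) (x : page) (y : option page) :
    {set page} :=
  x |: (if y is Some p then c :\ p else c).

Fixpoint legal (c : {set page}) (xs : seq page) (ys : seq (option page)) :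
    bool :=
  match xs, ys with
  | [::], [::] => true
  | x :: xs', y :: ys' =>
      legal_answer c x y && legal (next_cache c x y) xs' ys'
  | _, _ => false
  end.

Definition evictions (ys : seq (option page)) : nat := count isSome ys.

(* The neutral element n of the minimum is harmless: no answer sequence of
   length n evicts more than n pages, and for 0 < k and #|c| <= k a legal one
   exists. *)
Definition opt_cost n (c : {set page}) (I : n.-tuple page) : nat :=
  \big[minn/n]_(ys : n.-tuple (option page) | legal c I ys) evictions ys.

End Paging.

Section Quantum.

Variables (R : realType) (N : nat).

Local Notation page := 'I_N.
Local Notation C := R[i].

(* A quantum operation from s qubits to b qubits, in Kraus form. *)
Record channel (s b : nat) := Channel {
  ch_index : finType;
  ch_op : ch_index -> 'M[C]_(2 ^ b, 2 ^ s);
  ch_complete : \sum_j (ch_op j)^t* *m ch_op j = 1%:M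
}.

(* An online algorithm with shared qubits receiving b qubits of advice.
   Before the computation it prepares the (possibly entangled) pure state
   [qa_init] of [qa_kept + qa_sent] qubits and hands the last [qa_sent] of them
   to the Adviser; mixed preparations and workspace are covered by taking
   [qa_kept] large. Upon each request it performs a general measurement of its
   qubits and of the b advice qubits, with operators [qa_meas xs os o] for
   outcome o, and then answers. The classical part of the algorithm is
   unrestricted: measurements and answers may depend on all the requests xs
   received so far, the current one included, and on all the outcomes os
   observed so far. *)
Record shared_qalgorithm (b : nat) := SharedQAlgorithm {
  qa_kept : nat;
  qa_sent : nat;
  qa_init : 'cV[C]_(2 ^ qa_kept * 2 ^ qa_sent);
  qa_init_norm : qa_init^t* *m qa_init = 1%:M;
  qa_outcome : finType;
  qa_meas : seq page -> seq qa_outcome -> qa_outcome ->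
            'M[C]_(2 ^ qa_kept * 2 ^ b);
  qa_meas_complete : forall xs os,
    \sum_o (qa_meas xs os o)^t* *m qa_meas xs os o = 1%:M;
  qa_answer : seq page -> seq qa_outcome -> option page
}.

Variables (b : nat) (A : shared_qalgorithm b).

(* The joint state of the kept qubits and the advice once the Adviser has
   applied E to the qubits sent to it. *)
Definition advised_state (E : channel (qa_sent A) b) :
    'M[C]_(2 ^ qa_kept A * 2 ^ b) :=
  \sum_j let V := (1%:M : 'M[C]_(2 ^ qa_kept A)) *t @ch_op _ _ E j in
         V *m (qa_init A *m (qa_init A)^t*) *m V^t*.

(* The unnormalised state left after the requests xs if the outcomes os are
   observed, from state rho and with past requests hx and outcomes ho; its
   trace is the probability of observing os. *)
Fixpoint branch (hx : seq page) (ho : seq (qa_outcome A))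
    (rho : 'M[C]_(2 ^ qa_kept A * 2 ^ b))
    (xs : seq page) (os : seq (qa_outcome A)) :
    'M[C]_(2 ^ qa_kept A * 2 ^ b) :=
  match xs, os with
  | x :: xs', o :: os' =>
      let K := qa_meas (rcons hx x) ho o in
      branch (rcons hx x) (rcons ho o) (K *m rho *m K^t*) xs' os'
  | _, _ => rho
  end.

Definition answers (xs : seq page) (os : seq (qa_outcome A)) :
    seq (option page) :=
  [seq qa_answer (take i.+1 xs) (take i.+1 os) | i <- iota 0 (size xs)].

Definition outcome_prob n (I : n.-tuple page) (E : channel (qa_sent A) b)
    (os : n.-tuple (qa_outcome A)) : R :=
  complex.Re (\tr (branch [::] [::] (advised_state E) I os)).

Definition expected_cost n (I : n.-tuple page) (E : channel (qa_sent A) b) :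
    R :=
  \sum_(os : n.-tuple (qa_outcome A))
    outcome_prob I E os * (evictions (answers I os))%:R.

(* Legality is required whatever the advice and the outcomes are. *)
Definition solves_paging k n (c : {set page}) : Prop :=
  forall (I : n.-tuple page) (os : n.-tuple (qa_outcome A)),
    legal k c I (answers I os).

Definition optimal_paging k n (c : {set page}) : Prop :=
  forall I : n.-tuple page, exists E : channel (qa_sent A) b,
    expected_cost I E <= (opt_cost k c I)%:R.

End Quantum.

(* Main.v *)
(* Classical part: bits marking cached pages as "kept until its next request by
   a fixed optimal solution" or not suffice to be optimal. If each fault on a
   full cache reads only the bits of the unmarked pages, in a fixed order and up
   to the first page that may be evicted, then a "keep" bit can be charged to
   the later request hitting the page and an "evict" bit to the fault, so at
   most n bits are read; the last of them is an "evict" bit, which need not be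
   sent. Hence n - 1 bits suffice, and n - 1 <= 2 * (n / 2).
   Quantum part: with n / 2 shared EPR pairs, dense coding transmits these bits
   with n / 2 qubits; the Adviser applies a Pauli operator to its halves, and
   the algorithm measures in the generalized Bell basis. *)
Require Import Defs.
From mathcomp Require Import all_boot all_order all_algebra.
From mathcomp Require Import reals.
From mathcomp.real_closed Require Import complex mxtens.
From mathcomp Require Import zify.

Set Implicit Arguments.
Unset Strict Implicit.
Unset Printing Implicit Defensive.

(* [reverse_coercion], inserted by the elaboration of [{set 'I_N}], hides equal
   cardinals from [lia]. *)
Ltac card_lia := unfold reverse_coercion in *; simpl in *; lia.

(** * Classical paging with lazily read advice bits *)

Section LazyPaging.
Variables N k : nat.
Implicit Types (c d K : {set 'I_N}) (w : seq bool) (x p : 'I_N).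
Implicit Types (xs : seq 'I_N) (ys : seq (option 'I_N)).

(* The default value is a cached page, so that the answer is legal whatever the
   bits are. *)
Definition victim c K w x : 'I_N :=
  nth (head x (enum c)) (enum (c :\: K)) (find id w).

(* [K] is the set of pages marked to be kept until their next request and [w]
   the unread advice. A fault on a full cache reads one bit per unmarked page,
   [false] marking the page, until [true], or the end of the advice, designates
   the victim. *)
Fixpoint lazy_answers c K w xs : seq (option 'I_N) :=
  if xs is x :: xs' then
    if (x \in c) || (#|c| < k) then
      None :: lazy_answers (next_cache c x None) (K :\ x) w xs'
    else
      Some (victim c K w x) ::
      lazy_answers (next_cache c x (Some (victim c K w x)))
        (K :|: [set p in take (find id w) (enum (c :\: K))])
        (drop (find id w).+1 w) xs'
  else [::].

Lemma size_lazy_answers c K w xs : size (lazy_answers c K w xs) = size xs.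
Proof.
by elim: xs c K w => //= x xs IH c K w; case: ifP => _ /=; rewrite IH.
Qed.

(** Expresses that the strategy is online: later requests do not affect earlier answers. *)
Lemma take_lazy_answers i c K w xs :
  take i (lazy_answers c K w xs) = lazy_answers c K w (take i xs).
Proof.
elim: xs i c K w => [|x xs IH] [|i] c K w; rewrite ?take0 //=.
by case: ifP => _; rewrite /= IH.
Qed.

Lemma mem_victim c K w x : 0 < #|c| -> victim c K w x \in c.
Proof.
move=> c_gt0; rewrite /victim.
have [lt_w|ge_w] := ltnP (find id w) (size (enum (c :\: K))).
  by have := mem_nth (head x (enum c)) lt_w; rewrite mem_enum inE => /andP[].
rewrite nth_default // -mem_enum.
by move: c_gt0; rewrite cardE; case: (enum c) => //= p s _; rewrite mem_head.
Qed.

Lemma legal_lazy_answers c K w xs :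
  0 < k -> legal k c xs (lazy_answers c K w xs).
Proof.
move=> k_gt0; elim: xs c K w => //= x xs IH c K w.
case: ifP => [/= xc | /negbT xc] /=; rewrite /legal_answer IH andbT.
  by rewrite xc.
rewrite (negbTE xc); move: xc; rewrite negb_or -leqNgt => /andP[_ le_kc].
exact/mem_victim/(leq_trans k_gt0).
Qed.

(** A page never requested again does not count as kept, even if it stays in the cache; so every
    mark can be charged to a later request. *)
Fixpoint kept p xs ys : bool :=
  match xs, ys with
  | x :: xs', y :: ys' => (x == p) || (y != Some p) && kept p xs' ys'
  | _, _ => false
  end.

Lemma kept_requested p xs ys : kept p xs ys -> p \in xs.
Proof.
elim: xs ys => [|x xs IH] [|y ys] //=; rewrite inE (eq_sym x).
by case: (p == x) => //= /andP[_ /IH].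
Qed.

Lemma card_kept K xs ys : {in K, forall p, kept p xs ys} -> #|K| <= size xs.
Proof.
move=> K_kept; apply: leq_trans (card_size xs).
by apply/subset_leq_card/subsetP => p /K_kept /kept_requested.
Qed.

(* In the bound on [m], the marks in [K] are charged to future requests, and the
   last designation of a victim is left to the end of the advice. *)
Lemma lazy_answers_opt c d K xs ys m :
  legal k d xs ys -> #|c| <= #|d| -> #|d| <= k ->
  {in d, forall p, kept p xs ys -> p \in c} ->
  K \subset d -> {in K, forall p, kept p xs ys} ->
  size xs <= m + #|K| + 1 ->
  exists2 w, size w = m &
    evictions (lazy_answers c K w xs) <= evictions ys.
Proof.
elim: xs ys c d K m => [|x xs IH] [|y ys] c d K m //=.
  by exists (nseq m false); rewrite ?size_nseq.
case/andP=> legal_y legal_ys le_cd le_dk kept_c Kd K_kept le_m.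
set d' := next_cache d x y in legal_ys.
have d'P p : p \in d' -> p != x -> p \in d /\ y != Some p.
  rewrite /d' /next_cache !inE => /orP[-> //|].
  by case: y {legal_y legal_ys d' kept_c K_kept} => [q|//]; rewrite !inE;
     case/andP=> qp -> _; split=> //; rewrite (inj_eq Some_inj) eq_sym.
have in_d' p : p \in d -> y != Some p -> p \in d'.
  rewrite /d' /next_cache => pd.
  case: y {legal_y legal_ys d' d'P kept_c K_kept}.
    by move=> q qp; rewrite !inE pd (contraNneq _ qp) ?orbT // => ->.
  by rewrite !inE pd orbT.
have kept_d' p : p \in d' -> p != x -> kept p xs ys -> p \in c.
  move=> pd' px p_kept; have [pd yp] := d'P p pd' px.
  by apply: kept_c => //=; rewrite yp p_kept orbT.
have KP p : p \in K -> p != x -> p \in d' /\ kept p xs ys.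
  move=> pK px; have := K_kept p pK; rewrite eq_sym (negPf px) /=.
  by case/andP=> yp ->; split=> //; apply: in_d' => //; apply: (subsetP Kd).
have card_d' : #|d'| <= k /\ ((x \notin d) -> #|d'| = minn #|d|.+1 k).
  move: legal_y; rewrite /legal_answer /d' /next_cache.
  have [xd|xd] /= := boolP (x \in d).
    by move/eqP=> ->; rewrite cardsU1 xd.
  have [lt_dk|ge_dk] := ltnP.
    by move/eqP=> ->; rewrite cardsU1 xd /=; split=> [|_]; card_lia.
  case: y {legal_ys d' d'P in_d' kept_d' KP kept_c K_kept} => // q qd.
  have := cardsD1 q d; rewrite qd cardsU1 !inE (negPf xd) andbF /=.
  by move=> Dd; split=> [|_]; card_lia.
case: card_d' => le_d'k card_d'.
have ge_d'd : #|d| <= #|d'|.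
  have [xd|xd] := boolP (x \in d); last by rewrite card_d' //; card_lia.
  move: legal_y; rewrite /legal_answer xd /= /d' => /eqP ->.
  by rewrite /next_cache cardsU1 xd.
have [xc|xc] /= := boolP ((x \in c) || (#|c| < k)).
  have [w size_w le_w] : exists2 w, size w = m &
      evictions (lazy_answers (x |: c) (K :\ x) w xs) <= evictions ys.
    apply: (IH _ _ d') => //.
    - rewrite cardsU1; have [xc'|xc'] /= := boolP (x \in c).
        exact: leq_trans le_cd ge_d'd.
      move: xc; rewrite (negPf xc') /= => lt_ck.
      rewrite card_d'; first by card_lia.
      (* If [x] were in [d], it would be kept up to the present request, hence lie in [c]. *)
      by apply: contra xc' => xd; apply: kept_c => //=; rewrite eqxx.
    - move=> p pd' p_kept; rewrite !inE.
      by have [//|px] := eqVneq p x; apply: kept_d'.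
    - by apply/subsetP=> p; rewrite in_setD1 => /andP[px /KP/(_ px)[]].
    - by move=> p; rewrite in_setD1 => /andP[px /KP/(_ px)[]].
    (* The present request pays for the mark on [x], if there is one. *)
    - have := cardsD1 x K; case: (x \in K) => /=; card_lia.
  by exists w => //; apply: leq_trans (leq_addl _ _).
move: xc; rewrite negb_or -leqNgt => /andP[xc le_kc].
have xd : x \notin d.
  by apply: contra xc => xd; apply: kept_c => //=; rewrite eqxx.
have [q qd def_y] : exists2 q, q \in d & y = Some q.
  move: legal_y; rewrite /legal_answer (negPf xd) ltnNge (leq_trans le_kc) //=.
  case: y {legal_ys d' d'P in_d' kept_d' KP card_d' le_d'k ge_d'd kept_c K_kept}
    => // q qd.
  by exists q.
(* [nk] selects the pages that may be evicted: the reference solution [ys] with cache [d] lacks them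
   or does not keep them until a further request. *)
pose nk p := ~~ ((p \in d) && kept p (x :: xs) (y :: ys)).
pose l := enum (c :\: K).
(* Otherwise [c] would lie in [d :\ q], since the evicted [q] is not kept; but [c] has at least [k]
   pages and [d] at most [k]. *)
have has_nk : has nk l.
  have [p pc pnk] : exists2 p, p \in c & nk p.
    apply/exists_inP; rewrite -negb_forall_in; apply/negP=> /forall_inP all_k.
    have sub : c \subset d :\ q.
      apply/subsetP=> p pc; have := all_k _ pc; rewrite /= => /andP[pd /=].
      rewrite !inE pd andbT def_y (inj_eq Some_inj) (eq_sym q).
      have [->|//] := eqVneq p q; rewrite /= orbF => /eqP xq.
      by rewrite -xq (negPf xd) in qd.
    by have := subset_leq_card sub; have := cardsD1 q d; rewrite qd; card_lia.
  apply/hasP; exists p => //; rewrite mem_enum inE pc andbT.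
  by apply: contra pnk => pK; rewrite (subsetP Kd) //=; apply: K_kept.
set a := find nk l.
have lt_al : a < size l by rewrite -has_find.
set S := [set p in take a l].
have S_P p : p \in S ->
  [/\ p \in c, p \notin K, p \in d & kept p (x :: xs) (y :: ys)].
  rewrite inE => p_ta.
  have := mem_take p_ta; rewrite mem_enum inE => /andP[pK pc].
  have: ~~ nk p.
    apply: contraL p_ta => nkp; apply/negP=> p_ta.
    have: has nk (take a l) by apply/hasP; exists p.
    by rewrite has_take // ltnn.
  by rewrite negbK => /andP[pd p_kept]; split.
have KS_P p : p \in K :|: S -> [/\ p \in d', p \in c & kept p xs ys].
  rewrite inE => pKS.
  have [pc pd p_kept] : [/\ p \in c, p \in d & kept p (x :: xs) (y :: ys)].
    case/orP: pKS => [pK|/S_P[]//]; have pd := subsetP Kd p pK.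
    by split=> //; [apply: kept_c => // |]; apply: K_kept.
  have px : x != p by apply: contraNneq xc => ->.
  move: p_kept; rewrite /= (negPf px) /= => /andP[yp ->].
  by split=> //; apply: in_d'.
have card_S : #|S| = a.
  have uniq_ta : uniq (take a l) by rewrite take_uniq ?enum_uniq.
  by rewrite cardsE (card_uniqP uniq_ta) size_takel // ltnW.
have card_KS : #|K :|: S| = #|K| + a.
  rewrite cardsU card_S (_ : K :&: S = set0) ?cards0 ?subn0 //.
  apply/setP=> p; rewrite in_setI in_set0.
  by apply/negP=> /andP[pK /S_P[_]]; rewrite pK.
(* Old and new marks belong to distinct pages still to be requested; with the bound on [m] this
   yields [a <= m]. *)
have le_KS : #|K| + a <= size xs.
  by rewrite -card_KS; apply: (@card_kept _ _ ys) => p /KS_P[].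
set v := nth (head x (enum c)) l a.
have /andP[vK vc] : (v \notin K) && (v \in c).
  by have := mem_nth (head x (enum c)) lt_al; rewrite mem_enum inE.
have v_nk : nk v by apply: nth_find.
have [w' size_w' le_w'] : exists2 w', size w' = m - a.+1 &
    evictions (lazy_answers (x |: (c :\ v)) (K :|: S) w' xs) <= evictions ys.
  apply: (IH _ _ d') => //.
  - have := cardsD1 v c; rewrite vc cardsU1 !inE (negPf xc) andbF /= => Dc.
    by rewrite card_d' //; card_lia.
  - move=> p pd' p_kept; rewrite !inE.
    have [//|px] /= := eqVneq p x; rewrite kept_d' // andbT.
    (* A page that has to stay in the cache is kept by [ys], hence differs from [v]. *)
    apply: contraNneq v_nk => <-; have [pd yp] := d'P p pd' px.
    by rewrite pd /= yp p_kept orbT.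
  - by apply/subsetP=> p /KS_P[].
  - by move=> p /KS_P[].
  - by rewrite card_KS; card_lia.
(* If [a = m], no bit is left for [true]: the end of the advice designates the victim, and the
   truncated [m - a.+1] is 0. *)
pose w := nseq a false ++ (if a < m then true :: w' else [::]).
have size_w : size w = m.
  by rewrite size_cat size_nseq; case: ltnP => /= am; card_lia.
have find_w : find id w = a.
  rewrite find_cat has_nseq andbF size_nseq.
  by case: ifP => _ /=; rewrite addn0.
have drop_w : drop a.+1 w = w'.
  rewrite drop_cat size_nseq ltnNge leqnSn /= subSnn.
  case: ltnP => am /=; first by rewrite drop0.
  by apply/esym/size0nil; card_lia.
exists w => //; rewrite def_y /victim find_w drop_w -/l -/v.
exact: (leq_add (leqnn 1) le_w').
Qed.

(** The neutral element [n] of the minimum is covered by any legal sequence, which evicts at most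
    once per request. *)
Lemma opt_cost_attained n c (I : n.-tuple 'I_N) :
  0 < k -> exists2 ys, legal k c I ys & evictions ys <= opt_cost k c I.
Proof.
move=> k_gt0; rewrite /opt_cost.
apply: (big_ind (fun m => exists2 ys, legal k c I ys & evictions ys <= m)).
- exists (lazy_answers c set0 [::] I); first exact: legal_lazy_answers.
  by apply: leq_trans (count_size _ _) _; rewrite size_lazy_answers size_tuple.
- move=> m1 m2 [ys1 legal1 le1] [ys2 legal2 le2].
  by rewrite /minn; case: ifP => _; [exists ys1 | exists ys2].
- by move=> ys legal_ys; exists ys.
Qed.

Lemma lazy_answers_optimal n c (I : n.-tuple 'I_N) m :
  0 < k -> #|c| <= k -> n <= m.+1 ->
  exists w : m.-tuple bool,
    evictions (lazy_answers c set0 w I) <= opt_cost k c I.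
Proof.
move=> k_gt0 le_ck le_nm.
have [ys legal_ys le_ys] := opt_cost_attained c I k_gt0.
have [||||w /eqP size_w le_w] :=
  lazy_answers_opt (K := set0) (m := m) legal_ys (leqnn _) le_ck.
- by [].
- exact: sub0set.
- by move=> p; rewrite inE.
- by rewrite size_tuple cards0 addn0 addn1.
by exists (Tuple size_w); exact: leq_trans le_w le_ys.
Qed.

End LazyPaging.

Import Order.TTheory GRing.Theory Num.Theory.
Local Open Scope ring_scope.
Local Open Scope sesquilinear_scope.

(** * Dense coding: Pauli operators, EPR pairs and the Bell basis *)

Section DenseCoding.
Variables (C : numClosedFieldType) (b : nat).

Local Notation D := (2 ^ b)%N.
Local Notation bits := {ffun 'I_b -> bool}.

Lemma card_bits : #|{: bits}| = D.
Proof. by rewrite card_ffun card_bool card_ord. Qed.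

Definition code (i : 'I_D) : bits := enum_val (cast_ord (esym card_bits) i).

Lemma code_bij : bijective code.
Proof.
exact: bij_comp (@enum_val_bij bits) (Bijective (cast_ordK _) (cast_ordKV _)).
Qed.

Definition addb_bits (f g : bits) : bits := [ffun j => f j (+) g j].

Lemma addb_bitsI f : injective (addb_bits f).
Proof.
move=> g h /ffunP eq_gh; apply/ffunP => j; have := eq_gh j.
by rewrite !ffunE => /addbI.
Qed.

Lemma addb_bitsC f g : addb_bits f g = addb_bits g f.
Proof. by apply/ffunP=> j; rewrite !ffunE addbC. Qed.

(** The characters of the group of bit strings under [addb_bits]. *)
Definition character (f g : bits) : C := \prod_j (-1) ^+ (f j && g j).

Lemma character_sqr f g : character f g * character f g = 1.
Proof.
by rewrite -big_split big1 // => j _; rewrite /= -signr_addb addbb.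
Qed.

Lemma conj_character f g : (character f g)^* = character f g.
Proof. by rewrite rmorph_prod; apply: eq_bigr => j _; rewrite rmorph_sign. Qed.

(** The sum factors over the bits, and a bit where [f] and [g] differ contributes the factor 1 +
    (-1) = 0. *)
Lemma character_orthogonal f g :
  \sum_h character f h * character g h = D%:R * (f == g)%:R.
Proof.
pose F (j : 'I_b) (t : bool) : C := (-1) ^+ (f j && t) * (-1) ^+ (g j && t).
have -> : \sum_h character f h * character g h = \prod_j \sum_t F j t.
  by rewrite bigA_distr_bigA; apply: eq_bigr => h _; rewrite -big_split.
have [eq_fg|] := eqVneq f g.
  rewrite mulr1 (eq_bigr (fun _ => 2)) ?prodr_const ?card_ord ?natrX // => j _.
  by rewrite big_bool /F -eq_fg -!signr_addb !addbb.
move=> ne_fg; have /existsP[j ne_j] : [exists j, f j != g j].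
  by rewrite -negb_forall; apply: contra ne_fg => /eqfunP ?; apply/eqP/ffunP.
rewrite mulr0 (bigD1 j) //= big_bool /F !andbT !andbF expr0 mulr1 -signr_addb.
have -> : f j (+) g j by rewrite -negb_eqb.
by rewrite expr1 /= addNr mul0r.
Qed.

(** The operator X^a Z^c on [b] qubits: signs given by [c], then bit flips given by [a]. *)
Definition pauli (a c : 'I_D) : 'M[C]_D :=
  \matrix_(j, i)
    ((code j == addb_bits (code a) (code i))%:R * character (code c) (code i)).

Lemma sum_code (F : bits -> C) : \sum_i F (code i) = \sum_f F f.
Proof. by rewrite (reindex code) //; apply/onW_bij/code_bij. Qed.

Lemma sum_code_eq f g :
  \sum_i (code i == f)%:R * (code i == g)%:R = (f == g)%:R :> C.
Proof.
rewrite (sum_code (fun h => (h == f)%:R * (h == g)%:R)) (bigD1 f) //=.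
rewrite eqxx mul1r.
by rewrite big1 ?addr0 // => h /negPf->; rewrite mul0r.
Qed.

Lemma pauli_unitary a c : (pauli a c)^t* *m pauli a c = 1%:M.
Proof.
apply/matrixP=> i i'; rewrite !mxE.
under eq_bigr do rewrite !mxE rmorphM /= conjC_nat conj_character mulrACA.
rewrite -mulr_suml sum_code_eq (inj_eq (@addb_bitsI _)).
rewrite (inj_eq (bij_inj code_bij)).
by have [<-|] := eqVneq i i'; rewrite ?mul0r // character_sqr mulr1.
Qed.

Lemma trmxCE m n (A : 'M[C]_(m, n)) i j : A^t* i j = (A j i)^*.
Proof. by rewrite !mxE. Qed.

Lemma sum_mxtens (F : 'I_(D * D) -> C) :
  \sum_r F r = \sum_i \sum_j F (mxtens_index (i, j)).
Proof.
rewrite pair_big (reindex (@mxtens_index D D)) /=.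
  by apply: eq_bigr => -[].
exists (@mxtens_unindex D D) => r _; first exact: mxtens_indexK.
exact: mxtens_unindexK.
Qed.

Definition epr_amplitude : C := sqrtC (D%:R^-1).

Lemma epr_amplitude_sqr : epr_amplitude * epr_amplitude = D%:R^-1.
Proof. by rewrite -expr2 sqrtCK. Qed.

Lemma conj_epr_amplitude : epr_amplitude^* = epr_amplitude.
Proof. by rewrite geC0_conj // sqrtC_ge0 invr_ge0. Qed.

Lemma natr_dim_neq0 : D%:R != 0 :> C.
Proof. by rewrite pnatr_eq0 expn_eq0. Qed.

Definition epr_pairs : 'cV[C]_(D * D) :=
  \col_r (epr_amplitude *
          ((mxtens_unindex r).1 == (mxtens_unindex r).2)%:R).

Lemma epr_pairsE i j z :
  epr_pairs (mxtens_index (i, j)) z = epr_amplitude * (i == j)%:R.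
Proof. by rewrite mxE mxtens_indexK. Qed.

Lemma epr_pairs_norm : epr_pairs^t* *m epr_pairs = 1%:M.
Proof.
apply/matrixP=> z z'; rewrite !ord1 {z z'} mxE sum_mxtens.
rewrite (eq_bigr (fun _ => D%:R^-1)) => [|i _].
  by rewrite sumr_const card_ord mxE eqxx -[LHS]mulr_natr mulVf ?natr_dim_neq0.
rewrite (bigD1 i) //= big1 ?addr0 => [|j ji]; rewrite trmxCE !epr_pairsE.
  by rewrite eqxx mulr1 conj_epr_amplitude epr_amplitude_sqr.
by rewrite eq_sym (negPf ji) !mulr0.
Qed.

Definition bell_basis : 'M[C]_(D * D) :=
  \matrix_(r, m)
    (epr_amplitude * pauli (mxtens_unindex m).1 (mxtens_unindex m).2
                       (mxtens_unindex r).2 (mxtens_unindex r).1).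

Lemma bell_basisE i j a c :
  bell_basis (mxtens_index (i, j)) (mxtens_index (a, c))
  = epr_amplitude * pauli a c j i.
Proof. by rewrite mxE !mxtens_indexK. Qed.

(** Summing over the second half forces [a = a']; the sum left over the first half is the
    orthogonality of characters. *)
Lemma bell_basis_unitary : bell_basis^t* *m bell_basis = 1%:M.
Proof.
apply/matrixP=> m m'.
case: (mxtens_indexP m) => a c; case: (mxtens_indexP m') => a' c'.
rewrite mxE sum_mxtens [RHS]mxE (inj_eq (can_inj (@mxtens_indexK D D))).
rewrite xpair_eqE.
have term i :
    \sum_j (bell_basis^t* (mxtens_index (a, c)) (mxtens_index (i, j)) *
    bell_basis (mxtens_index (i, j)) (mxtens_index (a', c')))
  = D%:R^-1 * (a == a')%:R *
    (character (code c) (code i) * character (code c') (code i)).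
  under eq_bigr => j _.
    rewrite trmxCE !bell_basisE !mxE !rmorphM /= conj_epr_amplitude conjC_nat.
    rewrite conj_character mulrACA epr_amplitude_sqr mulrACA.
    over.
  rewrite -mulr_sumr -mulr_suml sum_code_eq ![addb_bits _ (code i)]addb_bitsC.
  by rewrite (inj_eq (@addb_bitsI _)) (inj_eq (bij_inj code_bij)) mulrA.
rewrite (eq_bigr _ (fun i _ => term i)) -mulr_sumr.
rewrite (sum_code (fun f => character (code c) f * character (code c') f)).
rewrite character_orthogonal (inj_eq (bij_inj code_bij)) mulrACA.
by rewrite mulVf ?natr_dim_neq0 // mul1r -natrM mulnb.
Qed.

(** Dense coding proper: operators on the second half alone turn the shared state into any of the
    [D * D] orthonormal Bell vectors. *)
Lemma pauli_epr_pairs a c :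
  (1%:M *t pauli a c) *m epr_pairs = col (mxtens_index (a, c)) bell_basis.
Proof.
apply/matrixP=> r z; case: (mxtens_indexP r) => i j.
rewrite [RHS]mxE bell_basisE mxE sum_mxtens (bigD1 i) //=.
rewrite [X in _ + X]big1 ?addr0 => [|i' ii']; last first.
  by rewrite big1 // => j' _; rewrite tensmxE mxE eq_sym (negPf ii') !mul0r.
rewrite (bigD1 i) //= big1 ?addr0 => [|j' jj']; rewrite tensmxE epr_pairsE.
  by rewrite mxE !eqxx mul1r mulr1 mulrC.
by rewrite eq_sym (negPf jj') !mulr0.
Qed.

Definition bell_projector m : 'M[C]_(D * D) :=
  col m bell_basis *m (col m bell_basis)^t*.

Lemma bell_orthonormal m m' :
  (col m bell_basis)^t* *m col m' bell_basis = (m == m')%:R%:M.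
Proof.
have /matrixP/(_ m m') := bell_basis_unitary; rewrite !mxE => eq_mm'.
apply/matrixP=> i j; rewrite !ord1 {i j} [RHS]mxE eqxx mulr1n -eq_mm' mxE.
by apply: eq_bigr => r _; rewrite !mxE.
Qed.

Lemma bell_projector_conj m : (bell_projector m)^t* = bell_projector m.
Proof. by rewrite /bell_projector trmx_mul map_mxM trmxCK. Qed.

Lemma bell_projectorM m m' :
  bell_projector m *m bell_projector m' = (m == m')%:R *: bell_projector m.
Proof.
rewrite /bell_projector mulmxA -(mulmxA (col m _)) bell_orthonormal.
have [<-|_] := eqVneq m m'; first by rewrite mulmx1 scale1r.
by rewrite scale0r raddf0 mulmx0 mul0mx.
Qed.

Lemma bell_projector_complete :
  \sum_m (bell_projector m)^t* *m bell_projector m = 1%:M.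
Proof.
(* The matrix is square, so orthonormality of its columns also gives completeness. *)
rewrite -(mulmx1C bell_basis_unitary).
apply/matrixP=> r s; rewrite summxE !mxE; apply: eq_bigr => m _.
rewrite bell_projector_conj bell_projectorM eqxx scale1r !mxE big_ord1.
by rewrite !mxE.
Qed.

Lemma bell_projector_trace m : \tr (bell_projector m) = 1.
Proof. by rewrite mxtrace_mulC bell_orthonormal eqxx mxtrace1. Qed.

End DenseCoding.

Lemma branch0 (R : realType) N b (A : shared_qalgorithm R N b) hx ho xs os :
  branch (A := A) hx ho 0 xs os = 0.
Proof.
by elim: xs os hx ho => [|x xs IH] [|o os] hx ho //=; rewrite mulmx0 mul0mx IH.
Qed.

(** * The paging algorithm with densely coded advice *)

Section DenseCodedPaging.
Variables (R : realType) (N k b : nat) (C0 : {set 'I_N}).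

Local Notation C := (complex R).
Local Notation D := (2 ^ b)%N.

Lemma card_advice : #|{: (b + b).-tuple bool}| = (D * D)%N.
Proof. by rewrite card_tuple card_bool expnD. Qed.

Definition decode (m : 'I_(D * D)) : (b + b).-tuple bool :=
  enum_val (cast_ord (esym card_advice) m).

Definition encode (w : (b + b).-tuple bool) : 'I_(D * D) :=
  cast_ord card_advice (enum_rank w).

Lemma encodeK : cancel encode decode.
Proof. by move=> w; rewrite /decode /encode cast_ordK enum_rankK. Qed.

Definition received (os : seq 'I_(D * D)) : seq bool :=
  if os is m :: _ then decode m else [::].

(* Measuring again in the Bell basis confirms the first outcome, so the same
   measurement can be performed at every step. *)
Definition dense_paging : shared_qalgorithm R N b :=
  @SharedQAlgorithm R N b b b (epr_pairs C b) (epr_pairs_norm C b) 'I_(D * D)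
    (fun _ _ => @bell_projector C b) (fun _ _ => bell_projector_complete C b)
    (fun xs os => last None (lazy_answers k C0 set0 (received os) xs)).

(** All nonempty prefixes of the outcomes share the first one, so the answers are the entries of a
    single run. *)
Lemma dense_paging_answers n (I : n.-tuple 'I_N)
    (os : n.-tuple (qa_outcome dense_paging)) :
  answers I os = lazy_answers k C0 set0 (received os) I.
Proof.
set s := lazy_answers _ _ _ _ _.
have size_s : size s = size I by rewrite size_lazy_answers.
rewrite /answers -size_s -[RHS](mkseq_nth None); apply/eq_in_map => i.
rewrite mem_iota /= => lt_i.
have -> : received (take i.+1 os) = received os by case: (os : seq _).
rewrite -take_lazy_answers -/s (last_nth None) size_takel //.
by rewrite -[_ :: _]/([:: None] ++ _) /= nth_take.
Qed.

Definition pauli_channel (m : 'I_(D * D)) : channel R b b.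
Proof.
pose U := pauli C (mxtens_unindex m).1 (mxtens_unindex m).2.
by exists unit (fun _ => U); rewrite (big_pred1 tt) ?pauli_unitary // => -[].
Defined.

Lemma advised_dense_paging m :
  advised_state (A := dense_paging) (pauli_channel m) = bell_projector C m.
Proof.
rewrite /advised_state (big_pred1 tt) /= => [|[] //].
set V := 1%:M *t _.
have -> : V *m (epr_pairs C b *m (epr_pairs C b)^t*) *m V^t* =
    (V *m epr_pairs C b) *m (V *m epr_pairs C b)^t*.
  by rewrite trmx_mul map_mxM !mulmxA.
by rewrite /V pauli_epr_pairs [mxtens_index _]mxtens_unindexK.
Qed.

(** Outcome [m] leaves the Bell state unchanged; any other outcome annihilates it. *)
Lemma branch_bell hx ho m xs os : size os = size xs ->
  branch (A := dense_paging) hx ho (bell_projector C m) xs os =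
  (os == nseq (size xs) m)%:R *: bell_projector C m.
Proof.
elim: xs os hx ho => [|x xs IH] [|o os] hx ho //=; rewrite ?scale1r //.
case=> size_os; rewrite bell_projector_conj bell_projectorM.
have [->|ne_om] := eqVneq o m.
  by rewrite scale1r bell_projectorM eqxx scale1r IH // eqseq_cons eqxx.
rewrite scale0r mul0mx eqseq_cons (negPf ne_om) scale0r.
by rewrite branch0.
Qed.

Lemma dense_paging_cost n (I : n.-tuple 'I_N) m :
  expected_cost (A := dense_paging) I (pauli_channel m) =
  (evictions (lazy_answers k C0 set0 (decode m) I))%:R.
Proof.
rewrite /expected_cost (bigD1 [tuple of nseq n m]) //=.
rewrite [X in _ + X]big1 ?addr0 => [|os ne_os].
  rewrite /outcome_prob advised_dense_paging branch_bell ?size_tuple //.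
  rewrite eqxx scale1r bell_projector_trace mul1r dense_paging_answers.
  (* For [n = 0] no outcome is received, but there is no request to answer either. *)
  by case: n I => [|n] I //; rewrite (tuple0 I).
rewrite /outcome_prob advised_dense_paging branch_bell ?size_tuple //.
rewrite (_ : (_ == _) = false) ?scale0r ?mxtrace0 ?mul0r //.
by apply: contraNF ne_os.
Qed.

End DenseCodedPaging.

Theorem theorem16 (R : realType) (N k n : nat) (C0 : {set 'I_N})
    (k_gt0 : (0 < k)%N) (k_ltN : (k < N)%N) (C0_le : (#|C0| <= k)%N) :
  exists A : shared_qalgorithm R N n./2,
    solves_paging A k n C0 /\ optimal_paging A k n C0.
Proof.
exists (dense_paging R k n./2 C0); split=> [I os|I].
  by rewrite dense_paging_answers; apply: legal_lazy_answers.
have [|w le_w] := lazy_answers_optimal (m := (n./2 + n./2)%N) I k_gt0 C0_le.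
  (* For odd [n], the bit missing from twice [n./2] is the one saved by the lazy reading. *)
  by rewrite addnn -{1}(odd_double_half n) -add1n leq_add2r leq_b1.
exists (pauli_channel R (encode w)).
by rewrite dense_paging_cost encodeK ler_nat.
Qed.
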